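(* Let $\mathbb{A}\colon\mathbb{R}^d\to\mathbb{R}^d$ be Lipschitz continuous and monotone, let $T>0$ and $X_0\in\mathbb{R}^d$. Then the system (Dual-Anchor ODE) \[ \dot X(t)=-Z(t)-\mathbb{A}(X(t)),\qquad \dot Z(t)=-\frac{1}{T-t}Z(t)-\frac{1}{T-t}\mathbb{A}(X(t)),\qquad t\in(0,T), \] with $X(0)=X_0$, $Z(0)=0$, has a unique solution $X\colon[0,T)\to\mathbb{R}^d$ (together with $Z$), the limit $X(T)=\lim_{t\to T^-}X(t)$ exists, and for every $X_\star\in\mathrm{Zer}\,\mathbb{A}$, \[ \|\mathbb{A}(X(T))\|^2\le\frac{4\|X_0-X_\star\|^2}{T^2}. \]
   Context: $\mathbb{A}$ is monotone if $\langle\mathbb{A}x-\mathbb{A}y,x-y\rangle\ge0$ for all $x,y$. $\mathrm{Zer}\,\mathbb{A}=\{x:\mathbb{A}x=0\}$. *)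

(* Defs.v *)
From HB Require Import structures.
From mathcomp Require Import all_boot all_order all_algebra.
From mathcomp Require Import all_classical all_reals all_analysis.
Set Implicit Arguments. Unset Strict Implicit. Unset Printing Implicit Defensive.
Import Order.TTheory GRing.Theory Num.Theory.
Import numFieldNormedType.Exports.
Local Open Scope classical_set_scope.
Local Open Scope ring_scope.

Definition dotv (R : realType) (d : nat) (u v : 'rV[R]_d) : R :=
  \sum_(i < d) u ord0 i * v ord0 i.
Definition enorm (R : realType) (d : nat) (u : 'rV[R]_d) : R :=
  Num.sqrt (dotv u u).

Definition lipschitz_op (R : realType) (d : nat) (A : 'rV[R]_d -> 'rV[R]_d) : Prop :=
  exists L : R, forall x y, enorm (A x - A y) <= L * enorm (x - y).

Definition monotone_op (R : realType) (d : nat) (A : 'rV[R]_d -> 'rV[R]_d) : Prop :=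
  forall x y, 0 <= dotv (A x - A y) (x - y).

Definition dual_anchor_sol (R : realType) (d : nat) (A : 'rV[R]_d -> 'rV[R]_d)
  (T : R) (X0 : 'rV[R]_d) (X Z : R -> 'rV[R]_d) : Prop :=
  [/\ X 0 = X0, Z 0 = 0,
      X t @[t --> 0^'+] --> X0,
      Z t @[t --> 0^'+] --> (0 : 'rV[R]_d) &
      forall t : R, 0 < t < T ->
        [/\ derivable X t 1, derivable Z t 1,
            derive1 X t = - Z t - A (X t) &
            derive1 Z t = - ((T - t)^-1 *: Z t) - (T - t)^-1 *: A (X t)]].

(* Main.v *)
(* In the time [s = - ln (1 - t / T)] the system is globally Lipschitz, so
   Picard iteration gives a solution on all of [0, T); Gronwall gives
   uniqueness. Put [W = Z + A X = - X']. Since [Z' = X' / (T - t)], formal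
   differentiation and monotonicity give [d|W|^2/dt <= - 2 |W|^2 / (T - t)],
   so that [|W| / (T - t)] is nonincreasing; as [A] is only Lipschitz, this is
   proved for difference quotients of [X]. Hence [X] converges to some [XT] and
   [Z] to [- A XT], at a linear rate. With [U = Z + A XT] and [Y = X - XT] the
   function [<U, Y> / (T - t) - |U|^2 / 2] has derivative
   [- <A X - A XT, Y> / (T - t)^2 <= 0] and tends to 0 at T, so its value
   [<A XT, X0 - XT> / T - |A XT|^2 / 2] at 0 is nonnegative. Adding
   [<A XT, XT - Xs> >= 0] and applying Cauchy-Schwarz gives the bound. *)

Require Import Defs.
From HB Require Import structures.
From mathcomp Require Import all_boot all_order all_algebra.
From mathcomp Require Import all_classical all_reals all_analysis.
From mathcomp Require Import ring lra.
Import Order.TTheory GRing.Theory Num.Theory.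
Import numFieldNormedType.Exports.
Set Implicit Arguments.
Unset Strict Implicit.
Unset Printing Implicit Defensive.
Local Open Scope classical_set_scope.
Local Open Scope ring_scope.

(** * Mean value inequalities and geometric sequences *)

Section calculus.
Context {R : realType}.
Implicit Types (f g df dg : R -> R) (a b : R).

(** Mean value theorem for [g - f]. Derivatives are required only inside the interval, so an
    endpoint with mere one-sided continuity is allowed. *)
Lemma ler_is_derive f g df dg a b : a <= b ->
  {within `[a, b], continuous f} -> {within `[a, b], continuous g} ->
  (forall x, a < x < b -> is_derive x 1 f (df x)) ->
  (forall x, a < x < b -> is_derive x 1 g (dg x)) ->
  (forall x, a < x < b -> df x <= dg x) ->
  f b - f a <= g b - g a.
Proof.
rewrite le_eqVlt => /predU1P[->|ab] cf cg Hf Hg le_df; first by rewrite !subrr.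
have [||c] := @MVT R (g - f) (fun x => dg x - df x) a b ab.
- by move=> x; rewrite in_itv/= => xab; apply: is_deriveB; [exact: Hg|exact: Hf].
- exact: within_continuousB.
rewrite in_itv/= => cab gfE.
have : 0 <= (g - f) b - (g - f) a.
  by rewrite gfE mulr_ge0 ?subr_ge0 ?(ltW ab)// le_df.
by rewrite !fctE; lra.
Qed.

Lemma ler_norm_is_derive f g df dg a b : a <= b ->
  {within `[a, b], continuous f} -> {within `[a, b], continuous g} ->
  (forall x, a < x < b -> is_derive x 1 f (df x)) ->
  (forall x, a < x < b -> is_derive x 1 g (dg x)) ->
  (forall x, a < x < b -> `|df x| <= dg x) ->
  `|f b - f a| <= g b - g a.
Proof.
move=> ab cf cg Hf Hg le_df; rewrite ler_norml; apply/andP; split.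
  rewrite lerNl; have := @ler_is_derive (- f) g (fun x => - df x) dg a b ab.
  rewrite !fctE opprB opprK addrC; apply => //.
  - by move=> x; apply: continuousN; exact: cf.
  - by move=> x xab; apply: is_deriveN; exact: Hf.
  - by move=> x xab; rewrite (le_trans _ (le_df x xab))// -normrN ler_norm.
apply: (@ler_is_derive f g df dg) => // x xab.
by rewrite (le_trans (ler_norm _))// le_df.
Qed.

Lemma is_derive_continuous f (x l : R) : is_derive x 1 f l -> {for x, continuous f}.
Proof. by move=> [fx _]; apply/differentiable_continuous/derivable1_diffP. Qed.

Lemma is_derive_within f df a b :
  (forall x, a <= x <= b -> is_derive x 1 f (df x)) ->
  {within `[a, b], continuous f}.
Proof.
move=> Hf; apply: continuous_in_subspaceT => x; rewrite inE/= in_itv/= => xab.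
exact: is_derive_continuous (Hf x xab).
Qed.

Lemma is_derive_mull (k x : R) : is_derive x 1 (fun y : R => k * y) k.
Proof.
apply: (is_derive_eq (is_deriveZ k (is_derive_id x (1 : R)))).
by rewrite /GRing.scale/= mulr1.
Qed.

Lemma is_derive_expM (k s : R) :
  is_derive s 1 (fun x => expR (k * x)) (k * expR (k * s)).
Proof.
rewrite mulrC; apply: (@is_derive1_comp _ expR (fun x => k * x)).
exact: is_derive_mull.
Qed.

(** From [n] to [n.+1] the margin [2 * c / 2 ^+ n] shrinks by [c / 2 ^+ n], the largest possible
    step of [u]. Hence [u] minus and plus the margin are adjacent sequences, and their common limit
    lies between them for each [n]. *)
Lemma geometric_cauchy (u : nat -> R) c :
  (forall n, `|u n.+1 - u n| <= c / 2 ^+ n) ->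
  exists l, forall n, `|u n - l| <= 2 * c / 2 ^+ n.
Proof.
move=> uc.
have step n : 2 * c / 2 ^+ n.+1 = c / 2 ^+ n.
  by rewrite exprS invfM; field; rewrite expf_neq0.
have half n : 2 * c / 2 ^+ n = c / 2 ^+ n + c / 2 ^+ n by ring.
pose a n := u n - 2 * c / 2 ^+ n; pose b n := u n + 2 * c / 2 ^+ n.
have nda : nondecreasing_seq a.
  apply/nondecreasing_seqP => n; rewrite /a step half.
  by have := uc n; rewrite ler_norml; lra.
have nib : nonincreasing_seq b.
  apply/nonincreasing_seqP => n; rewrite /b step half.
  by have := uc n; rewrite ler_norml; lra.
have ba0 : b - a @ \oo --> 0.
  have -> : b - a = geometric (4 * c) 2^-1.
    by apply/funext => n; rewrite /a /b !fctE/= exprVn; ring.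
  by apply: cvg_geometric; rewrite gtr0_norm ?invf_lt1// ltr1n.
have [ablim cb ca] := adjacent_seq nda nib ba0.
exists (limn a) => n; have := nondecreasing_cvgn_le nda cb n.
have := nonincreasing_cvgn_ge nib ca n; rewrite ablim ler_norml /a /b; lra.
Qed.

End calculus.

(** * Primitives of continuous functions, extended to the whole line *)

Section primitive.
Context {R : realType}.
Variable f : R -> R.
Hypothesis cf : continuous f.

Let F : R -> R := parameterized_integral lebesgue_measure 0 ^~ f.

Let intf (u : R) : lebesgue_measure.-integrable `[0, u] (EFin \o f).
Proof.
apply: continuous_compact_integrable; first exact: segment_compact.
exact: continuous_subspaceT.
Qed.

Lemma is_derive_primitive (s : R) : 0 < s -> is_derive s 1 F (f s).
Proof.
move=> s0; have s1 : s < s + 1 by rewrite ltrDl.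
have [] := continuous_FTC1_closed s1 (intf (s + 1)) s0 (@cf s).
move=> dF F'; apply: DeriveDef; first exact: dF.
by rewrite -derive1E; exact: F'.
Qed.

(** The segment from 0 to [s] is empty or a single point. The Picard iterates are thus total
    functions, constant to the left of 0, and their continuity can be stated on the whole line. *)
Lemma primitive_nonpos (s : R) : s <= 0 -> F s = 0.
Proof.
rewrite /F /parameterized_integral le_eqVlt => /predU1P[->|s0].
  by rewrite set_itv1 Rintegral_set1.
by rewrite set_itv_ge ?Rintegral_set0// -leNgt bnd_simp.
Qed.

Lemma continuous_primitive : continuous F.
Proof.
move=> s; have [s0|s0|->] := ltgtP s 0.
- apply: (near_cst_continuous (0 : R)); near=> x; apply: primitive_nonpos.
  by near: x; exact: lt_le_nbhsl.
- exact: is_derive_continuous (is_derive_primitive s0).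
- rewrite /continuous_at primitive_nonpos//.
  exact: (parameterized_integral_cvg_left ltr01).
Unshelve. all: by end_near. Qed.

End primitive.

(* In the sup norm over [J] weighted by [expR (2 * K * s)], the iteration
   contracts by a factor 2 on the whole half-line. *)
Section picard.
Context {R : realType} {J : Type}.
Variables (F : R -> (J -> R) -> J -> R) (y0 : J -> R) (K M : R).
Hypothesis K0 : 0 < K.
Hypothesis FL : forall (s : R) u v (B : R), 0 <= s -> (forall j, `|u j - v j| <= B) ->
  forall j, `|F s u j - F s v j| <= K * B.
Hypothesis FC : forall u : R -> J -> R, (forall j, continuous (u ^~ j)) ->
  forall j, continuous (fun s => F s (u s) j).
Hypothesis FM : forall (s : R) j, 0 <= s -> `|F s y0 j| <= M.

Let w (s : R) := expR (2 * K * s).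

Let w_ge0 s : 0 <= w s. Proof. exact: expR_ge0. Qed.

(** The weight grows at rate [2 * K], so [K * (B * w s)] is the derivative of [B / 2 * w s]:
    integration gains the factor 2. *)
Let weight_bound (f df : R -> R) (B : R) : 0 <= B -> continuous f ->
  (forall s : R, s <= 0 -> f s = 0) ->
  (forall s : R, 0 < s -> is_derive s 1 f (df s)) ->
  (forall s : R, 0 < s -> `|df s| <= K * (B * w s)) ->
  forall s : R, `|f s| <= B / 2 * w s.
Proof.
move=> B0 cf f0 f' dfB s; have [s0|s0] := leP s 0.
  by rewrite f0// normr0 mulr_ge0// divr_ge0.
pose g (x : R) := B / 2 * w x.
have w' (x : R) : is_derive x 1 g (K * (B * w x)).
  apply: is_derive_eq (is_deriveZ (B / 2) (is_derive_expM (2 * K) x)) _.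
  by rewrite /GRing.scale/=/w; field.
have := @ler_norm_is_derive _ f g df (fun x => K * (B * w x)) 0 s.
rewrite (f0 0)// subr0 => /(_ (ltW s0)) fs.
apply: le_trans (fs _ _ _ (fun x _ => w' x) _) _.
- exact: continuous_subspaceT.
- by apply: (is_derive_within (df := fun x => K * (B * w x))) => x _.
- by move=> x /andP[x0 _]; exact: f'.
- by move=> x /andP[x0 _]; exact: dfB.
by rewrite lerBlDr lerDl mulr_ge0// divr_ge0.
Qed.

Let next (u : R -> J -> R) : R -> J -> R := fun s j =>
  y0 j + parameterized_integral lebesgue_measure 0 s (fun r => F r (u r) j).

Let y_ n := iter n next (fun=> y0).

Let next_nonpos u (s : R) j : s <= 0 -> next u s j = y0 j.
Proof. by move=> s0; rewrite /next primitive_nonpos ?addr0. Qed.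

Let next_continuous u : (forall j, continuous (u ^~ j)) ->
  forall j, continuous (next u ^~ j).
Proof.
move=> cu j s; apply: cvgD; first exact: cvg_cst.
by apply: continuous_primitive; exact: FC.
Qed.

Let next_is_derive u (s : R) j : (forall j, continuous (u ^~ j)) -> 0 < s ->
  is_derive s 1 (next u ^~ j) (F s (u s) j).
Proof.
move=> cu s0; rewrite -[X in is_derive _ _ _ X]add0r.
apply: (@is_deriveD _ _ _ (cst (y0 j))).
by apply: is_derive_primitive => //; exact: FC.
Qed.

Let y_continuous n j : continuous (y_ n ^~ j).
Proof.
elim: n j => [|n IH] j; first by move=> s; exact: cvg_cst.
exact: next_continuous.
Qed.

Let next_contract u v (B : R) : 0 <= B ->
  (forall j, continuous (u ^~ j)) -> (forall j, continuous (v ^~ j)) ->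
  (forall (s : R) j, `|u s j - v s j| <= B * w s) ->
  forall (s : R) j, `|next u s j - next v s j| <= B / 2 * w s.
Proof.
move=> B0 cu cv uv s j.
apply: (@weight_bound (next u ^~ j - next v ^~ j)
  (fun s => F s (u s) j - F s (v s) j)) => //.
- by move=> x; apply: continuousB; exact: next_continuous.
- by move=> x x0; rewrite !fctE !next_nonpos ?subrr.
- by move=> x x0; apply: is_deriveB; exact: next_is_derive.
- by move=> x x0; apply: FL; [exact: ltW|exact: uv].
Qed.

Let y_step n s j : `|y_ n.+1 s j - y_ n s j| <= M / (2 * K) * w s / 2 ^+ n.
Proof.
have M0 : 0 <= M by apply: le_trans (FM j (lexx 0)).
elim: n s j => [|n IH] s j.
  (* [weight_bound] is used with [B = M / K]: the derivative [F s y0] is at most [M], hence at most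
     [K * (M / K * w s)], as the weight is at least 1 for [s >= 0]. *)
  rewrite expr0 divr1 /= (_ : M / (2 * K) = M / K / 2); last first.
    by field; exact: lt0r_neq0.
  apply: (@weight_bound (next (fun=> y0) ^~ j - cst (y0 j))
    (fun s => F s y0 j - 0)).
  - by rewrite divr_ge0// ltW.
  - move=> x; apply: continuousB; last exact: cvg_cst.
    by apply: next_continuous => i z; exact: cvg_cst.
  - by move=> x x0; rewrite !fctE next_nonpos ?subrr.
  - move=> x x0; apply: is_deriveB; apply: next_is_derive => // i z.
    exact: cvg_cst.
  - move=> x x0; rewrite subr0; apply: le_trans (FM j (ltW x0)) _.
    rewrite (_ : K * _ = M * w x); last by field; exact: lt0r_neq0.
    by rewrite ler_peMr// -expR0 ler_expR !mulr_ge0// ltW.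
have := @next_contract (y_ n.+1) (y_ n) (M / (2 * K) / 2 ^+ n).
rewrite -/(y_ n.+2) -/(y_ n.+1) => H.
rewrite (_ : _ / _ = M / (2 * K) / 2 ^+ n / 2 * w s); last first.
  by rewrite exprS; field; rewrite expf_neq0//= lt0r_neq0.
apply: H.
- by rewrite !divr_ge0// ?mulr_ge0// ?exprn_ge0// ltW.
- exact: y_continuous.
- exact: y_continuous.
- by move=> x i; rewrite mulrAC; exact: IH.
Qed.

(** The iterates converge pointwise. The error bound is locally uniform in [s], which makes the
    limit continuous; the contraction makes it a fixed point of [next], which is then differentiated
    as a primitive. *)
Theorem picard_lipschitz : exists y : R -> J -> R,
  [/\ y 0 = y0, forall j, continuous (y ^~ j) &
      forall (s : R) j, 0 < s -> is_derive s 1 (y ^~ j) (F s (y s) j)].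
Proof.
have /choice[y yl] : forall sj : R * J, exists l, forall n,
    `|y_ n sj.1 sj.2 - l| <= 2 * (M / (2 * K) * w sj.1) / 2 ^+ n.
  by move=> [s j]; apply: geometric_cauchy => n; exact: y_step.
pose C := M / K.
(* The sign of [M] is read off from [FM] at some index, and [J] may be empty. *)
have M0 (j : J) : 0 <= M by apply: le_trans (FM j (lexx 0)).
have C0 (j : J) : 0 <= C by rewrite divr_ge0 ?(M0 j)// ltW.
have {}yl n s j : `|y_ n s j - y (s, j)| <= C / 2 ^+ n * w s.
  rewrite (le_trans (yl (s, j) n))// le_eqVlt; apply/orP; left; apply/eqP.
  by rewrite /C; field; rewrite expf_neq0//= lt0r_neq0.
have small (c e : R) : 0 < e -> exists n, c / 2 ^+ n < e.
  move=> e0; have : geometric c 2^-1 n @[n --> \oo] --> 0.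
    by apply: cvg_geometric; rewrite gtr0_norm ?invf_lt1// ltr1n.
  move=> /cvgrPdist_lt/(_ _ e0)[n _ /(_ n (leqnn n))].
  rewrite sub0r normrN /= exprVn => /ltr_normlW cn.
  by exists n.
pose Y s j := y (s, j).
have cY j : continuous (Y ^~ j).
  (* As [w] is nondecreasing, a single [n] gives an error below [e / 3] at all points up to
     [s + 1]. *)
  move=> s; apply/cvgrPdist_lt => e e0.
  have [n Cn] := small (C * w (s + 1)) _ (divr_gt0 e0 (ltr0n _ 3)).
  have ync : \forall x \near s, `|y_ n s j - y_ n x j| < e / 3.
    have := @y_continuous n j s; move/cvgrPdist_lt/(_ (e / 3)); apply.
    by rewrite divr_gt0.
  near=> x.
  have bnd z : z <= s + 1 -> `|y_ n z j - Y z j| < e / 3.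
    move=> zs; rewrite (le_lt_trans (yl _ _ _))// (le_lt_trans _ Cn)//.
    rewrite [leRHS]mulrAC ler_wpM2l ?(divr_ge0 (C0 j)) ?exprn_ge0//.
    by rewrite /w ler_expR ler_pM2l ?mulr_gt0.
  have xs : x <= s + 1 by near: x; apply: lt_le_nbhsl; rewrite ltrDl.
  have ss : s <= s + 1 by rewrite lerDl.
  have ynx : `|y_ n s j - y_ n x j| < e / 3 by near: x.
  rewrite (le_lt_trans (ler_distD (y_ n s j) _ _))//.
  rewrite (le_lt_trans (lerD (lexx _) (ler_distD (y_ n x j) _ _)))//.
  rewrite (_ : e = e / 3 + (e / 3 + e / 3)); last by field.
  by rewrite distrC !ltrD ?bnd.
(* [y_ n.+1 = next (y_ n)] is close to [Y] by the error bound and to [next Y] by contraction. *)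
have YE : next Y = Y.
  apply/funext => s; apply/funext => j; apply/eqP; rewrite -subr_eq0 -normr_eq0.
  rewrite eq_le normr_ge0 andbT; apply/ler_addgt0Pl => e e0; rewrite addr0.
  have [n Cn] := small (C * w s) _ e0.
  have := @next_contract (y_ n) Y (C / 2 ^+ n) _ (@y_continuous n) cY.
  move=> /(_ (divr_ge0 (C0 j) (exprn_ge0 _ (ler0n _ _))) (yl n) s j).
  rewrite -/(y_ n.+1) => H1; have := yl n.+1 s j; rewrite -/(Y s j) => H2.
  rewrite (le_trans _ (ltW Cn))//.
  have -> : C * w s / 2 ^+ n = C / 2 ^+ n / 2 * w s + C / 2 ^+ n.+1 * w s.
    by rewrite exprS; field; rewrite expf_neq0.
  by rewrite (le_trans (ler_distD (y_ n.+1 s j) _ _))// lerD// distrC.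
exists Y; split => //.
  by rewrite -YE; apply/funext => j; rewrite next_nonpos.
by move=> s j s0; rewrite -{1}YE; exact: next_is_derive.
Unshelve. all: by end_near. Qed.

End picard.

(** * The Euclidean inner product and its comparison with coordinate bounds *)

Section dotv_theory.
Context {R : realType} {d : nat}.
Implicit Types (u v w : 'rV[R]_d) (a b : R).

Lemma dotvC u v : dotv u v = dotv v u.
Proof. by apply: eq_bigr => i _; rewrite mulrC. Qed.

Lemma dotvDl u v w : dotv (u + v) w = dotv u w + dotv v w.
Proof. by rewrite -big_split; apply: eq_bigr => i _; rewrite mxE mulrDl. Qed.

Lemma dotvZl a u v : dotv (a *: u) v = a * dotv u v.
Proof. by rewrite mulr_sumr; apply: eq_bigr => i _; rewrite mxE mulrA. Qed.

Lemma dotvNl u v : dotv (- u) v = - dotv u v.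
Proof. by rewrite -scaleN1r dotvZl mulN1r. Qed.

Lemma dotvDr u v w : dotv u (v + w) = dotv u v + dotv u w.
Proof. by rewrite dotvC dotvDl !(dotvC u). Qed.

Lemma dotvZr a u v : dotv u (a *: v) = a * dotv u v.
Proof. by rewrite dotvC dotvZl dotvC. Qed.

Lemma dotvNr u v : dotv u (- v) = - dotv u v.
Proof. by rewrite dotvC dotvNl dotvC. Qed.

Definition dotvE := (dotvDl, dotvDr, dotvNl, dotvNr, dotvZl, dotvZr).

Lemma dotv_ge0 u : 0 <= dotv u u.
Proof. by apply: sumr_ge0 => i _; rewrite -expr2 sqr_ge0. Qed.

Lemma sqr_coord_le u i : u ord0 i ^+ 2 <= dotv u u.
Proof.
rewrite /dotv (bigD1 i)//= -expr2 lerDl.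
by apply: sumr_ge0 => j _; rewrite -expr2 sqr_ge0.
Qed.

Lemma dotv_eq0 u : dotv u u <= 0 -> u = 0.
Proof.
move=> u0; apply/rowP => i; rewrite mxE; apply/eqP; rewrite -sqrf_eq0.
by rewrite eq_le sqr_ge0 andbT (le_trans (sqr_coord_le u i)).
Qed.

Lemma enorm_sqr u : enorm u ^+ 2 = dotv u u.
Proof. by rewrite /enorm sqr_sqrtr ?dotv_ge0. Qed.

Lemma enorm_ge0 u : 0 <= enorm u.
Proof. exact: sqrtr_ge0. Qed.

Lemma coord_le_enorm u i : `|u ord0 i| <= enorm u.
Proof. by rewrite -sqrtr_sqr /enorm ler_wsqrtr ?sqr_coord_le. Qed.

Lemma dotv_le_sup u v a b : (forall i, `|u ord0 i| <= a) ->
  (forall i, `|v ord0 i| <= b) -> `|dotv u v| <= d%:R * (a * b).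
Proof.
move=> ua vb; rewrite (le_trans (ler_norm_sum _ _ _))//.
rewrite -[X in _ <= X%:R * _]card_ord mulr_natl -sumr_const ler_sum// => i _.
by rewrite normrM ler_pM.
Qed.

Lemma enorm_le_sup u a : (forall i, `|u ord0 i| <= a) -> enorm u <= d%:R * a.
Proof.
(* In dimension 0 no coordinate yields the sign of [a], but both sides vanish. *)
move=> ua; have [d0|d0] := posnP d.
  rewrite (_ : enorm u = 0) ?d0 ?mul0r// /enorm /dotv big1 ?sqrtr0// => i.
  by have := ltn_ord i; rewrite {2}d0.
have a0 : 0 <= a by rewrite (le_trans _ (ua (Ordinal d0))).
rewrite /enorm -[leRHS]ger0_norm ?mulr_ge0// -sqrtr_sqr ler_wsqrtr// expr2.
rewrite (le_trans (ler_norm _))// (le_trans (dotv_le_sup ua ua))//.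
by rewrite mulrACA ler_wpM2r ?mulr_ge0// ler_peMr// ler1n.
Qed.

(** Expansion of the square of [u - v]. Applied to suitably scaled vectors, it takes the place of
    the Cauchy-Schwarz inequality. *)
Lemma dotv_amgm u v : 2 * dotv u v <= dotv u u + dotv v v.
Proof.
by have := dotv_ge0 (u - v); rewrite !dotvE (dotvC v u); lra.
Qed.

End dotv_theory.

(** * Coordinatewise differentiation and convergence of row vectors *)

Section row_calculus.
Context {R : realType} {d : nat}.

Lemma is_derive_rowP (u : R -> 'rV[R]_d) (t : R) (du : 'rV[R]_d) :
  is_derive t 1 u du <->
  forall i, is_derive t 1 (fun s => u s ord0 i) (du ord0 i).
Proof.
split=> [[ud <-] i|H].
  split; first by move/derivable_mxP : ud; exact.
  by rewrite derive_mx// mxE.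
have ud : derivable u t 1.
  by apply/derivable_mxP => i j; rewrite ord1; case: (H j).
split => //; rewrite derive_mx//; apply/rowP => i.
by rewrite mxE; case: (H i).
Qed.

Lemma is_derive_dotv (u v : R -> 'rV[R]_d) (t : R) (du dv : 'rV[R]_d) :
  is_derive t 1 u du -> is_derive t 1 v dv ->
  is_derive t 1 (fun s => dotv (u s) (v s)) (dotv du (v t) + dotv (u t) dv).
Proof.
move=> /is_derive_rowP Hu /is_derive_rowP Hv.
have := @is_derive_sum _ _ _ d
  (fun i => (fun s => u s ord0 i) * (fun s => v s ord0 i)) t 1 _
  (fun i => is_deriveM (Hu i) (Hv i)).
rewrite fct_sumE => H; apply: (is_derive_eq H).
rewrite /dotv -big_split/=; apply: eq_bigr => i _.
by rewrite addrC [du _ _ * _]mulrC.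
Qed.

Lemma cvg_rowP {T : Type} (F : set_system T) {FF : Filter F}
    (u : T -> 'rV[R]_d) (l : 'rV[R]_d) :
  u x @[x --> F] --> l <-> forall i, u x ord0 i @[x --> F] --> l ord0 i.
Proof.
split=> [ul i|ul].
  have ci := @coord_continuous R 1 d ord0 i l.
  exact: (continuous_cvg _ ci ul).
apply/cvgrPdist_le => e e0; near=> x.
rewrite [leLHS]/Num.Def.normr/= mx_normrE (bigmax_le _ (ltW e0))//= => -[i j] _.
rewrite ord1 !mxE/=; move: j; near: x; apply: filter_forall => j.
by move/cvgrPdist_le : (ul j); apply.
Unshelve. all: by end_near. Qed.

Lemma cvg_dotv {T : Type} (F : set_system T) {FF : Filter F}
    (u v : T -> 'rV[R]_d) (l m : 'rV[R]_d) :
  u x @[x --> F] --> l -> v x @[x --> F] --> m ->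
  dotv (u x) (v x) @[x --> F] --> dotv l m.
Proof.
move=> /cvg_rowP ul /cvg_rowP vm; rewrite /dotv.
by apply: cvg_big => [|i _]; [exact: add_continuous|exact: cvgM].
Qed.

End row_calculus.

(** * The Lipschitz condition in coordinates, in squared norm, and as continuity *)

Section lipschitz_operators.
Context {R : realType} {d : nat} (A : 'rV[R]_d -> 'rV[R]_d).
Hypothesis AL : lipschitz_op A.

Lemma lipschitz_op_sup : exists2 K : R, 0 < K & forall (x y : 'rV[R]_d) (B : R),
  (forall i, `|x ord0 i - y ord0 i| <= B) ->
  forall i, `|A x ord0 i - A y ord0 i| <= K * B.
Proof.
(* [L] may be negative, whence the absolute value; [d%:R] compares the Euclidean norm with the sup
   bound, and the added 1 makes the constant positive. *)
have [L LA] := AL; exists (`|L| * d%:R + 1) => [|x y B xyB i].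
  by rewrite ltr_wpDl// mulr_ge0.
have B0 : 0 <= B by rewrite (le_trans _ (xyB i)).
have := coord_le_enorm (A x - A y) i; rewrite !mxE => /le_trans; apply.
apply: le_trans (LA x y) _; apply: (@le_trans _ _ (`|L| * enorm (x - y))).
  by rewrite ler_wpM2r ?enorm_ge0// ler_norm.
apply: (@le_trans _ _ (`|L| * (d%:R * B))).
  by rewrite ler_wpM2l// enorm_le_sup// => j; rewrite !mxE.
by rewrite mulrA ler_wpM2r// lerDl.
Qed.

Lemma lipschitz_op_sqr : exists2 L : R, 0 <= L & forall x y,
  dotv (A x - A y) (A x - A y) <= L * dotv (x - y) (x - y).
Proof.
have [L LA] := AL; exists (L ^+ 2) => [|x y]; first exact: sqr_ge0.
rewrite -!enorm_sqr -exprMn ler_sqr ?nnegrE ?enorm_ge0//.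
exact: le_trans (enorm_ge0 _) (LA x y).
Qed.

Lemma cvg_lipschitz_op {T : Type} (F : set_system T) {FF : Filter F}
    (u : T -> 'rV[R]_d) (l : 'rV[R]_d) :
  u x @[x --> F] --> l -> A (u x) @[x --> F] --> A l.
Proof.
move=> /cvg_rowP ul; have [K K0 KA] := lipschitz_op_sup.
apply/cvg_rowP => i; apply/cvgrPdist_le => e e0; near=> x.
rewrite [leRHS](_ : _ = K * (e / K)); last by field; exact: lt0r_neq0.
apply: KA => {}i; move: i; near: x; apply: filter_forall => i.
by move/cvgrPdist_le : (ul i); apply; rewrite divr_gt0.
Unshelve. all: by end_near. Qed.

End lipschitz_operators.

(* In the logarithmic time [s = - ln (1 - t / T)] the singular system becomes
   [dX/ds = - T * expR (- s) *: (Z + A X)], [dZ/ds = - (Z + A X)], whose field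
   is Lipschitz uniformly over [s >= 0]. *)
Section existence.
Context {R : realType} {d : nat} (A : 'rV[R]_d -> 'rV[R]_d) (T : R).
Hypothesis AL : lipschitz_op A.
Hypothesis T0 : 0 < T.
Variable X0 : 'rV[R]_d.

(** The tag [true] marks a coordinate of [X], [false] one of [Z]; [coef] is the factor of [Z + A X]
    in the corresponding equation. *)
Let J := (bool * 'I_d)%type.
Let coef (s : R) (b : bool) : R := if b then - (T * expR (- s)) else -1.
Let part (u : J -> R) b : 'rV[R]_d := \row_i u (b, i).
Let F (s : R) (u : J -> R) (j : J) : R :=
  coef s j.1 * (u (false, j.2) + A (part u true) ord0 j.2).
Let y0 (j : J) : R := if j.1 then X0 ord0 j.2 else 0.

(** The factor [T * expR (- s)] is at most [T] for [s >= 0] but unbounded as [s] decreases to minus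
    infinity; hence the Picard bounds on [F] are stated on the half-line. *)
Let coef_le (s : R) b : 0 <= s -> `|coef s b| <= T + 1.
Proof.
move=> s0; rewrite /coef; case: b; rewrite normrN; last first.
  by rewrite normr1 lerDr ltW.
rewrite ger0_norm ?mulr_ge0 ?expR_ge0 ?(ltW T0)//.
apply: (@le_trans _ _ T); last by rewrite lerDl.
by rewrite ler_piMr ?(ltW T0)// -expR0 ler_expR oppr_le0.
Qed.

Let log_solution : exists y : R -> J -> R,
  [/\ y 0 = y0, forall j, continuous (y ^~ j) &
      forall (s : R) j, 0 < s -> is_derive s 1 (y ^~ j) (F s (y s) j)].
Proof.
have [K K0 KA] := lipschitz_op_sup AL.
apply: (@picard_lipschitz _ _ F y0 ((T + 1) * (1 + K))
  ((T + 1) * \sum_i `|A (part y0 true) ord0 i|)).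
- by rewrite mulr_gt0// addr_gt0.
- move=> s u v B s0 uvB [b i]; rewrite /F/= -mulrBr normrM -mulrA.
  rewrite ler_pM// ?coef_le// opprD addrACA (le_trans (ler_normD _ _))//.
  rewrite mulrDl mul1r lerD// KA// => k; rewrite !mxE.
  exact: uvB.
- move=> u cu [b i] s; rewrite /F/=; apply: cvgM.
    rewrite /coef; case: b; last exact: cvg_cst.
    apply: cvgN; apply: cvgM; first exact: cvg_cst.
    apply: (@continuous_comp _ _ _ -%R expR); first exact: opp_continuous.
    exact: continuous_expR.
  apply: cvgD; first exact: cu.
  have /cvg_rowP : A (part (u x) true) @[x --> s] --> A (part (u s) true).
    apply: cvg_lipschitz_op => //; apply/cvg_rowP => k.
    by rewrite mxE; under eq_fun do rewrite mxE; exact: cu.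
  exact.
- move=> s [b i] s0; rewrite /F/= /y0/= add0r normrM ler_pM// ?coef_le//.
  by rewrite (bigD1 i)//= lerDl sumr_ge0.
Qed.

Lemma dual_anchor_exists : exists X Z : R -> 'rV[R]_d, dual_anchor_sol A T X0 X Z.
Proof.
have [y [y00 cy y']] := log_solution.
pose sigma (t : R) := - ln (1 - t / T).
have sigma0 : sigma 0 = 0 by rewrite /sigma mul0r subr0 ln1 oppr0.
have frac (t : R) : t < T -> 0 < 1 - t / T.
  by move=> tT; rewrite subr_gt0 ltr_pdivrMr// mul1r.
have sigma' (t : R) : t < T -> is_derive t 1 sigma (T - t)^-1.
  move=> tT; have fT := frac t tT.
  have lin : is_derive t 1 (fun x : R => 1 - x / T) (- T^-1).
    rewrite (_ : (fun x => _) = cst 1 - (T^-1 \*: id)); last first.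
      by apply/funext => x; rewrite !fctE/= mulrC.
    apply: (is_derive_eq (is_deriveB (is_derive_cst _ _ _)
      (is_deriveZ _ (is_derive_id _ _)))).
    by rewrite sub0r /GRing.scale/= mulr1.
  have := is_deriveN (@is_derive1_comp _ (@ln R) (fun x => 1 - x / T) t _ _
    (is_derive1_ln fT) lin).
  move=> H; apply: (is_derive_eq H).
  by field; rewrite !lt0r_neq0// subr_gt0.
have sigma_gt0 (t : R) : 0 < t < T -> 0 < sigma t.
  move=> /andP[t0 tT]; rewrite oppr_gt0 -ln1 ltr_ln ?posrE ?frac//.
  by rewrite ltrBlDr ltrDl divr_gt0.
pose P b (t : R) := part (y (sigma t)) b.
have P' b (t : R) : 0 < t < T ->
    is_derive t 1 (P b) ((coef (sigma t) b / (T - t)) *: (P false t + A (P true t))).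
  move=> tT; apply/is_derive_rowP => i.
  rewrite (_ : (fun s => _) = (y ^~ (b, i)) \o sigma); last first.
    by apply/funext => s; rewrite mxE.
  have [_ ltT] := andP tT.
  have := @is_derive1_comp _ (y ^~ (b, i)) sigma t _ _
    (y' _ (b, i) (sigma_gt0 t tT)) (sigma' t ltT).
  by move=> H; apply: (is_derive_eq H); rewrite /F/= !mxE mulrAC.
(* Since [0 < T], [sigma] is differentiable at 0 from both sides, and [y] is continuous on the whole
   line: the right limit restricts a two-sided one. *)
have P0 b : P b t @[t --> 0^'+] --> P b 0.
  apply: cvg_at_right_filter; apply/cvg_rowP => i; rewrite mxE.
  under eq_fun do rewrite mxE.
  apply: (@continuous_comp _ _ _ sigma (y ^~ (b, i))); last exact: cy.
  exact: is_derive_continuous (sigma' 0 T0).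
have Pt0 : P true 0 = X0 by apply/rowP => i; rewrite mxE sigma0 y00.
have Pf0 : P false 0 = 0 by apply/rowP => i; rewrite !mxE sigma0 y00.
exists (P true), (P false); split => //.
- by have := P0 true; rewrite Pt0.
- by have := P0 false; rewrite Pf0.
move=> t tT; have [t0 ltT] := andP tT.
have [dX X'] := P' true t tT; have [dZ Z'] := P' false t tT.
have Tt0 : T - t != 0 by rewrite lt0r_neq0// subr_gt0.
split; [exact: dX|exact: dZ|rewrite derive1E..].
  (* [T * expR (- sigma t)] equals [T - t], which cancels the [(T - t)^-1] of the chain rule. *)
  rewrite X' /coef opprK lnK ?posrE ?frac// (_ : _ / _ = -1).
    by rewrite scaleN1r opprD.
  by field; rewrite Tt0 lt0r_neq0.
by rewrite Z' /coef mulN1r scaleNr scalerDr opprD.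
Qed.

End existence.

(** * Gronwall's inequality, and left limits of functions with bounded derivative *)

Section more_calculus.
Context {R : realType}.
Implicit Types (f df : R -> R) (a b : R).

Lemma is_derive_within_right f df a b : a < b ->
  (forall x, a < x <= b -> is_derive x 1 f (df x)) ->
  f x @[x --> a^'+] --> f a -> {within `[a, b], continuous f}.
Proof.
move=> ab f' fa; apply/(continuous_within_itvP _ ab); split => //.
- move=> x; rewrite in_itv/= => /andP[ax xb].
  by apply: is_derive_continuous (f' x _); rewrite ax ltW.
- apply: cvg_at_left_filter.
  by apply: is_derive_continuous (f' b _); rewrite ab lexx.
Qed.

(** The integrating factor [expR (- C * x)] turns the differential inequality into a nonpositive
    derivative. *)
Lemma gronwall_le0 f df (C b : R) : 0 < b ->
  (forall x, 0 < x <= b -> is_derive x 1 f (df x)) ->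
  f x @[x --> 0^'+] --> f 0 -> f 0 = 0 ->
  (forall x, 0 < x < b -> df x <= C * f x) -> f b <= 0.
Proof.
move=> b0 f' cf f0 dfC.
pose g := (fun x => expR (- C * x)) * f.
have g' (x : R) : 0 < x <= b ->
    is_derive x 1 g (expR (- C * x) * (df x - C * f x)).
  move=> xb; apply: is_derive_eq (is_deriveM (is_derive_expM (- C) x) (f' x xb)) _.
  by rewrite /GRing.scale/=; ring.
have cg : {within `[0, b], continuous g}.
  apply: is_derive_within_right g' _ => //.
  apply: cvgM; last exact: cf.
  apply: cvg_at_right_filter.
  exact: is_derive_continuous (is_derive_expM (- C) 0).
have := @ler_is_derive _ g (cst 0) (fun x => expR (- C * x) * (df x - C * f x))
  (cst 0) 0 b (ltW b0) cg.
rewrite /g !fctE f0 mulr0 !subr0 pmulr_rle0 ?expR_gt0//; apply.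
- by apply: continuous_subspaceT => x; exact: cvg_cst.
- by move=> x /andP[x0 xb]; apply: g'; rewrite x0 ltW.
- by move=> x xb; rewrite pmulr_rle0 ?expR_gt0// subr_le0 dfC.
Qed.

Lemma is_derive_subV (T x : R) : x < T ->
  is_derive x 1 (fun t => (T - t)^-1) ((T - x)^-1 ^+ 2).
Proof.
move=> xT; have Tx : T - x != 0 by rewrite lt0r_neq0// subr_gt0.
have := @is_deriveV _ (cst T - id) x _ 1 Tx
  (is_deriveB (is_derive_cst _ _ _) (is_derive_id _ _)).
move=> H; apply: (is_derive_eq H).
by rewrite sub0r /GRing.scale/= mulrNN mulr1 exprVn.
Qed.

(** [f] is Lipschitz with constant [C], so [f x + C * x] is nondecreasing and bounded above near
    [T], and has a left limit there. The rate is the Lipschitz bound with one point sent to [T]. *)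
Lemma cvg_left_bounded_derive f df (a T C : R) : a < T ->
  (forall x, a <= x < T -> is_derive x 1 f (df x)) ->
  (forall x, a <= x < T -> `|df x| <= C) ->
  exists2 l, f x @[x --> T^'-] --> l &
    forall x, a <= x < T -> `|f x - l| <= C * (T - x).
Proof.
move=> aT f' dfC.
have lipf x y : a <= x -> x <= y -> y < T -> `|f y - f x| <= C * (y - x).
  move=> ax xy yT.
  have in_aT z : x <= z <= y -> a <= z < T.
    by move=> /andP[xz zy]; rewrite (le_trans ax)//= (le_lt_trans zy).
  have lin (z : R) := is_derive_mull C z.
  rewrite mulrBr.
  apply: (@ler_norm_is_derive _ f (fun x => C * x) df (cst C)) => //.
  - by apply: (is_derive_within (df := df)) => z /in_aT; exact: f'.
  - by apply: (is_derive_within (df := cst C)) => z _; exact: lin.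
  - by move=> z /andP[xz zy]; apply: f'; apply: in_aT; rewrite !ltW.
  - by move=> z /andP[xz zy]; apply: dfC; apply: in_aT; rewrite !ltW.
have C0 : 0 <= C by apply: le_trans (dfC a _); rewrite ?lexx.
pose g x := f x + C * x.
have gl : cvg (g x @[x --> T^'-]).
  apply: nondecreasing_at_left_is_cvgr; near=> y;
    (have ay : a <= y by near: y; exact: nbhs_left_ge).
    move=> u v; rewrite !in_itv/= => /andP[yu _] /andP[_ vT] uv.
    have au : a <= u by rewrite ltW// (le_lt_trans ay).
    have := lipf _ _ au uv vT; rewrite /g mulrBr ler_norml; lra.
  exists (f a + C * (T - a) + C * T) => _/= [u + <-].
  rewrite in_itv/= => /andP[yu uT].
  have au : a <= u by rewrite ltW// (le_lt_trans ay).
  have := lipf _ _ (lexx a) au uT; rewrite /g ler_norml => /andP[_ fu].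
  have : C * (u - a) <= C * (T - a) by rewrite ler_wpM2l// lerB// ltW.
  have : C * u <= C * T by rewrite ler_wpM2l// ltW.
  move: fu; lra.
have /cvg_ex[m gm] := gl.
have fl : f x @[x --> T^'-] --> m - C * T.
  rewrite (_ : f = g - (fun x => C * x)); last first.
    by apply/funext => x; rewrite !fctE /g addrK.
  apply: cvgB => //; apply: cvg_at_left_filter.
  by apply: cvgM; [exact: cvg_cst|exact: cvg_id].
exists (m - C * T) => // x /andP[ax xT].
have cvn : `|f x - f y| @[y --> T^'-] --> `|f x - (m - C * T)|.
  by apply: cvg_norm; apply: cvgB => //; exact: cvg_cst.
apply: (cvgr_to_le cvn); near=> y.
have yT : y < T by near: y; exact: nbhs_left_lt.
have xy : x <= y by near: y; exact: nbhs_left_ge.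
rewrite distrC (le_trans (lipf _ _ ax xy yT))// ler_wpM2l// lerB// ltW//.
Unshelve. all: by end_near. Qed.

End more_calculus.

(** For two solutions, [x], [z], [a] are the differences of [X], [Z], [A X], and the left side is
    the derivative of [|x|^2 + |z|^2]. Monotonicity removes [<a, x>]. The cross term
    [- 2 * c * <z, a>] is split: its [z] half is absorbed by [- 2 * c * |z|^2], its [a] half is
    bounded by the Lipschitz condition. *)
Lemma difference_energy_le {R : realType} {d : nat} (x z a : 'rV[R]_d)
    (c cb L : R) : 0 <= c -> c <= cb -> 0 <= L -> 0 <= dotv a x ->
  dotv a a <= L * dotv x x ->
  (dotv (- (z + a)) x + dotv x (- (z + a))) +
  (dotv (c *: - (z + a)) z + dotv z (c *: - (z + a))) <=
  (1 + cb * L) * (dotv x x + dotv z z).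
Proof.
move=> c0 ccb L0 ax0 lip.
have := dotv_amgm x (- z); have := dotv_amgm z (- a).
have := dotv_ge0 x; have := dotv_ge0 z; have := dotv_ge0 a.
rewrite !dotvE (dotvC x a) (dotvC x z) (dotvC a z).
move: ax0 lip.
move: (dotv a a) (dotv x x) (dotv z z) (dotv a x)
  (dotv z x) (dotv z a) => aa xx zz ax zx za.
move=> ax0 lip aa0 zz0 xx0 am1 am2.
have cza : c * (- 2 * za) <= c * (zz + aa) by rewrite ler_wpM2l//; lra.
have caa : c * aa <= cb * (L * xx).
  by rewrite (le_trans (ler_wpM2l c0 lip))// ler_wpM2r// mulr_ge0.
have czz : 0 <= c * zz by rewrite mulr_ge0.
have : 0 <= cb * (L * zz) by rewrite !mulr_ge0// (le_trans c0).
by move: cza caa czz; lra.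
Qed.

(** * Uniqueness by an energy estimate *)

Section uniqueness.
Context {R : realType} {d : nat} (A : 'rV[R]_d -> 'rV[R]_d) (T : R).
Hypotheses (AL : lipschitz_op A) (AM : monotone_op A).
Variable X0 : 'rV[R]_d.

Lemma dual_anchor_is_derive X Z : dual_anchor_sol A T X0 X Z ->
  forall t : R, 0 < t < T -> is_derive t 1 X (- (Z t + A (X t))) /\
    is_derive t 1 Z (- ((T - t)^-1 *: (Z t + A (X t)))).
Proof.
move=> [_ _ _ _ sol] t tT; have [dX dZ X' Z'] := sol t tT.
split; apply: DeriveDef.
- exact: dX.
- by rewrite -derive1E X' opprD.
- exact: dZ.
- by rewrite -derive1E Z' scalerDr opprD.
Qed.

(** Gronwall for the squared distance [e] of the solutions. As [(T - t)^-1] is unbounded near [T],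
    each [b < T] is treated separately, with the bound [(T - b)^-1] up to [b]. *)
Lemma dual_anchor_unique X Z X' Z' :
  dual_anchor_sol A T X0 X Z -> dual_anchor_sol A T X0 X' Z' ->
  forall t : R, 0 <= t < T -> X' t = X t /\ Z' t = Z t.
Proof.
move=> S S' b /andP[]; rewrite le_eqVlt => /predU1P[<- _|b0 bT].
  by case: S => -> -> _ _ _; case: S' => -> ->.
pose W t := Z t + A (X t); pose W' t := Z' t + A (X' t).
pose DX t := X' t - X t; pose DZ t := Z' t - Z t.
pose e t := dotv (DX t) (DX t) + dotv (DZ t) (DZ t).
pose c (t : R) := (T - t)^-1.
pose dX t := - W' t - (- W t); pose dZ t := - (c t *: W' t) - (- (c t *: W t)).
pose de t := (dotv (dX t) (DX t) + dotv (DX t) (dX t)) +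
  (dotv (dZ t) (DZ t) + dotv (DZ t) (dZ t)).
have e' (t : R) : 0 < t <= b -> is_derive t 1 e (de t).
  move=> /andP[t0 tb]; have tT : 0 < t < T by rewrite t0 (le_lt_trans tb).
  have [X1 Z1] := dual_anchor_is_derive S tT.
  have [X2 Z2] := dual_anchor_is_derive S' tT.
  have DX' : is_derive t 1 DX (dX t) by exact: is_deriveB.
  have DZ' : is_derive t 1 DZ (dZ t) by exact: is_deriveB.
  exact: (is_deriveD (is_derive_dotv DX' DX') (is_derive_dotv DZ' DZ')).
have [L L0 LA] := lipschitz_op_sqr AL.
have [e0 ce] : e 0 = 0 /\ e t @[t --> 0^'+] --> 0.
  case: S => X00 Z00 X0c Z0c _; case: S' => X0' Z0' X0c' Z0c' _.
  have dot0 : dotv (0 : 'rV[R]_d) 0 = 0 by rewrite -(scale0r 0) dotvZl mul0r.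
  have cX : DX t @[t --> 0^'+] --> X0 - X0 by exact: cvgB.
  have cZ : DZ t @[t --> 0^'+] --> (0 : 'rV[R]_d) - 0 by exact: cvgB.
  split; first by rewrite /e /DX /DZ X00 Z00 X0' Z0' !subrr dot0 addr0.
  have := cvgD (cvg_dotv cX cX) (cvg_dotv cZ cZ).
  by rewrite !subrr dot0 addr0; apply.
have : e b <= 0.
  apply: (@gronwall_le0 _ e de (1 + c b * L) b) => //; first by rewrite e0.
  move=> t /andP[t0 tb].
  pose DA := A (X' t) - A (X t).
  have dXE : dX t = - (DZ t + DA).
    by apply/rowP => i; rewrite !mxE; ring.
  have dZE : dZ t = c t *: dX t.
    by rewrite /dZ /dX scalerBr !scalerN.
  have tT : t < T by rewrite (lt_trans tb).
  have ct : 0 <= c t by rewrite invr_ge0 subr_ge0 ltW.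
  have cb : c t <= c b by rewrite lef_pV2 ?posrE ?subr_gt0// lerB// ltW.
  have mon : 0 <= dotv DA (DX t) by exact: AM.
  have lip : dotv DA DA <= L * dotv (DX t) (DX t) by exact: LA.
  by rewrite /de /e dZE dXE; exact: difference_energy_le.
rewrite /e => eb.
have X0e : dotv (DX b) (DX b) <= 0 by have := dotv_ge0 (DZ b); lra.
have Z0e : dotv (DZ b) (DZ b) <= 0 by have := dotv_ge0 (DX b); lra.
by split; apply/eqP; rewrite -subr_eq0; apply/eqP; exact: dotv_eq0.
Qed.

End uniqueness.

(** For increments [x], [z], [a] of [X], [Z], [A X], with [p = (T - t)^-1] and [r = T - t], the left
    side is the derivative of [p ^+ 2 * |x|^2]. It equals [- 2 * p ^+ 3 * <r *: z - x, x> - 2 * p ^+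
    2 * <a, x>], whose last term is nonpositive. *)
Lemma scaled_difference_rate {R : realType} {d : nat} (x z a : 'rV[R]_d)
    (p c r B : R) : 0 < p -> p <= c -> p * r = 1 -> 0 <= dotv a x ->
  `|dotv (r *: z - x) x| <= B ->
  p ^+ 2 * 2 * p * dotv x x +
  p ^+ 2 * (dotv (- (z + a)) x + dotv x (- (z + a))) <= 2 * c ^+ 3 * B.
Proof.
move=> p0 pc pr ax0; rewrite (dotvC x) !dotvE.
move: ax0; move: (dotv z x) (dotv x x) (dotv a x) => zx xx ax ax0 phi.
rewrite [leLHS](_ : _ = 2 * p ^+ 3 * (- (r * zx - xx)) - 2 * p ^+ 2 * ax -
  2 * p ^+ 2 * zx * (1 - p * r)); last by ring.
rewrite pr subrr mulr0 subr0.
have ax1 : 0 <= 2 * p ^+ 2 * ax by rewrite !mulr_ge0 ?exprn_ge0// ltW.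
have p3 : 0 <= 2 * p ^+ 3 by rewrite !mulr_ge0 ?exprn_ge0// ltW.
apply: (@le_trans _ _ (2 * p ^+ 3 * `|r * zx - xx|)).
  by rewrite lerBlDr ler_wpDr// ler_wpM2l// -normrN ler_norm.
by rewrite ler_pM// ler_wpM2l// lerXn2r// nnegrE ltW// (lt_le_trans p0).
Qed.

(** * Monotone decay of the scaled velocity *)

Section velocity_bound.
Context {R : realType} {d : nat} (A : 'rV[R]_d -> 'rV[R]_d) (T : R).
Hypotheses (AL : lipschitz_op A) (AM : monotone_op A).
Variables X Z : R -> 'rV[R]_d.

Let W t := Z t + A (X t).

Hypothesis X' : forall t : R, 0 < t < T -> is_derive t 1 X (- W t).
Hypothesis Z' : forall t : R, 0 < t < T ->
  is_derive t 1 Z (- ((T - t)^-1 *: W t)).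

Lemma is_derive_row_continuous (u : R -> 'rV[R]_d) (t : R) (du : 'rV[R]_d) :
  is_derive t 1 u du -> u s @[s --> t] --> u t.
Proof.
move=> /is_derive_rowP u'; apply/cvg_rowP => i.
exact: is_derive_continuous (u' i).
Qed.

(** The vector bounded here is minus the derivative of [Z], and [T - s] times it is minus that of
    [X], so one bound serves both. It comes from the extreme value theorem, [W] being continuous. *)
Lemma bounded_velocity (a b : R) : 0 < a -> a <= b -> b < T ->
  exists2 M : R, 0 <= M & forall s i, a <= s <= b ->
    `|((T - s)^-1 *: W s) ord0 i| <= M.
Proof.
move=> a0 ab bT.
pose q s := dotv ((T - s)^-1 *: W s) ((T - s)^-1 *: W s).
have cq : {within `[a, b], continuous q}.
  apply: continuous_in_subspaceT => s; rewrite inE/= in_itv/= => /andP[as_ sb].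
  have sT : 0 < s < T by rewrite (lt_le_trans a0 as_) (le_lt_trans sb).
  have [_ ltT] := andP sT.
  have cW : W x @[x --> s] --> W s.
    apply: cvgD; first exact: is_derive_row_continuous (Z' sT).
    by apply: cvg_lipschitz_op => //; exact: is_derive_row_continuous (X' sT).
  suff cV : (T - x)^-1 *: W x @[x --> s] --> (T - s)^-1 *: W s.
    exact: cvg_dotv.
  by apply: cvgZ => //; exact: is_derive_continuous (is_derive_subV ltT).
have [c _ qc] := EVT_max ab cq.
exists (Num.sqrt (q c)) => [|s i sab]; first exact: sqrtr_ge0.
rewrite (le_trans (coord_le_enorm _ _))// /enorm ler_wsqrtr//.
by apply: qc; rewrite in_itv.
Qed.

(** Divided by [h ^+ 2], this tends to [|W t|^2 / (T - t)^2] as [h] decreases to 0. It is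
    differentiable in [t], which [W] need not be. *)
Let sqdiff (h t : R) :=
  (T - t)^-1 ^+ 2 * dotv (X (t + h) - X t) (X (t + h) - X t).

(* Monotonicity makes [|X (t + h) - X t| / (T - t)] nonincreasing in [t] up to
   an error of higher order in [h], because [(T - t) *: (Z (t + h) - Z t)] and
   [X (t + h) - X t] agree to first order. *)
Lemma difference_quotient_le (t1 t2 : R) : 0 < t1 -> t1 <= t2 -> t2 < T ->
  exists2 C : R, 0 <= C & \forall h \near 0^'+,
    sqdiff h t2 - sqdiff h t1 <= C * h ^+ 3.
Proof.
(* [t3] lies strictly between [t2] and [T]; for [h <= t3 - t2] the points [t + h] stay where the
   velocity bound [M] holds. *)
move=> t10 t12 t2T; pose t3 := (t2 + T) / 2.
have t23 : t2 < t3 by rewrite /t3; lra.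
have t3T : t3 < T by rewrite /t3; lra.
have [M M0 VM] := bounded_velocity t10 (ltW (le_lt_trans t12 t23)) t3T.
pose c := (T - t3)^-1.
have c0 : 0 < c by rewrite invr_gt0 subr_gt0.
(* Collects the bounds [M * h ^+ 2] and [T * M * h] found below, the dimension factor, and the
   [2 * c ^+ 3] of [scaled_difference_rate]. *)
pose C := 2 * c ^+ 3 * (d%:R * (M * (T * M))).
have T0 : 0 < T by lra.
have C0 : 0 <= C.
  by rewrite /C !mulr_ge0 ?ler0n ?exprn_ge0// ltW.
exists (C * (t2 - t1)); first by rewrite mulr_ge0// subr_ge0.
near=> h.
have h0 : 0 < h by near: h; exact: nbhs_right_gt.
have ht3 : h <= t3 - t2 by near: h; apply: nbhs_right_le; rewrite subr_gt0.
pose N := sqdiff h; rewrite -/N.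
have in0T (s : R) : t1 <= s <= t3 -> 0 < s < T.
  by move=> /andP[? ?]; rewrite (lt_le_trans t10)//= (le_lt_trans _ t3T).
have inner (t s : R) : t1 <= t <= t2 -> t <= s <= t + h -> t1 <= s <= t3.
  by move=> /andP[? ?] /andP[? ?]; apply/andP; split; lra.
have hM0 : 0 <= h * M by rewrite mulr_ge0// ltW.
have lin (k z : R) := is_derive_mull k z.
have incr (t : R) (f df : R -> R) k : t1 <= t <= t2 ->
    (forall s, t <= s <= t + h -> is_derive s 1 f (df s)) ->
    (forall s, t <= s <= t + h -> `|df s| <= k) ->
    `|f (t + h) - f t| <= k * h.
  move=> tt f' dfk.
  rewrite (_ : k * h = k * (t + h) - k * t); last by ring.
  apply: (@ler_norm_is_derive _ f (fun x => k * x) df (cst k)).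
  - by rewrite lerDl ltW.
  - exact: is_derive_within f'.
  - by apply: (is_derive_within (df := cst k)) => z _; exact: lin.
  - by move=> s /andP[? ?]; apply: f'; rewrite !ltW.
  - by move=> s _; exact: lin.
  - by move=> s /andP[? ?]; apply: dfk; rewrite !ltW.
pose p (t : R) := (T - t)^-1.
pose DX t := X (t + h) - X t; pose DZ t := Z (t + h) - Z t.
have XZ (s : R) i : s < T -> (W s) ord0 i = (T - s) * (p s *: W s) ord0 i.
  move=> sT; rewrite [X in _ = _ * X]mxE mulrA mulfV ?mul1r//.
  by rewrite lt0r_neq0// subr_gt0.
have DXle (t : R) i : t1 <= t <= t2 -> `|DX t ord0 i| <= T * M * h.
  move=> tt; rewrite /DX !mxE.
  apply: (incr t (fun s => X s ord0 i) (fun s => (- W s) ord0 i) _ tt).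
  - by move=> s /(inner t s tt)/in0T/X' /is_derive_rowP; exact.
  - move=> s /(inner t s tt) st; have /andP[s0 sT] := in0T s st.
    rewrite mxE normrN XZ// normrM ler_pM ?VM//.
    by rewrite gtr0_norm ?subr_gt0// gerBl ltW.
(* With [t] frozen, [(T - t) *: Z s - X s] has derivative [(t - s) *: (p s *: W s)], with
   coordinates at most [h * M] over a length [h]: this gains the second order. *)
have phile (t : R) i : t1 <= t <= t2 ->
    `|((T - t) *: DZ t - DX t) ord0 i| <= M * h ^+ 2.
  move=> tt.
  rewrite (_ : _ ord0 i = ((T - t) * Z (t + h) ord0 i - X (t + h) ord0 i) -
    ((T - t) * Z t ord0 i - X t ord0 i)); last by rewrite !mxE; ring.
  rewrite (_ : M * h ^+ 2 = h * M * h); last by ring.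
  apply: (incr t (fun s => (T - t) * Z s ord0 i - X s ord0 i)
     (fun s => (T - t) * (- (p s *: W s)) ord0 i - (- W s) ord0 i) _ tt).
  - move=> s /(inner t s tt)/in0T sT.
    have /is_derive_rowP/(_ i) X1 := X' sT; have /is_derive_rowP/(_ i) Z1 := Z' sT.
    exact: (is_deriveB (is_deriveZ (T - t) Z1) X1).
  - move=> s ts; have st := inner t s tt ts; have /andP[s0 sT] := in0T s st.
    rewrite [X in _ - X]mxE XZ// [X in _ * X - _]mxE.
    rewrite (_ : _ - _ = (t - s) * (p s *: W s) ord0 i); last by ring.
    have /andP[? ?] := ts.
    by rewrite normrM ler_pM ?VM// distrC ger0_norm ?subr_ge0//; lra.
pose dX t := - W (t + h) - (- W t).
pose dN t := (p t ^+ 2 * 2 * p t) * dotv (DX t) (DX t) +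
   p t ^+ 2 * (dotv (dX t) (DX t) + dotv (DX t) (dX t)).
have N' (t : R) : t1 <= t <= t2 -> is_derive t 1 N (dN t).
  move=> tt; have tT : 0 < t < T.
    by apply/in0T/(inner t t tt); rewrite lexx lerDl ltW.
  have htT : 0 < t + h < T.
    by apply/in0T/(inner t _ tt); rewrite lexx lerDl ltW.
  have Xh : is_derive t 1 (fun s => X (s + h)) (- W (t + h)).
    apply/is_derive_rowP => i; have /is_derive_rowP/(_ i) X1 := X' htT.
    have sh : is_derive t 1 (fun s : R => s + h) 1.
      have := is_deriveD (is_derive_id t (1 : R)) (is_derive_cst h t 1).
      by move=> H; apply: (is_derive_eq H); rewrite addr0.
    have := @is_derive1_comp _ (fun s => X s ord0 i) (fun s => s + h) t _ _ X1 sh.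
    by move=> H; apply: (is_derive_eq H); rewrite mulr1.
  have DX' : is_derive t 1 DX (dX t) by exact: (is_deriveB Xh (X' tT)).
  have /andP[_ ltT] := tT.
  have p' := is_derive_subV ltT.
  have := is_deriveM (is_deriveX 2 p') (is_derive_dotv DX' DX').
  move=> H; apply: (is_derive_eq H).
  rewrite /dN /p exprfctE /GRing.scale/= expr1; ring.
have dNle (t : R) : t1 <= t <= t2 -> dN t <= C * h ^+ 3.
  move=> tt; have [/andP[_ t2t] tT] : t1 <= t <= t2 /\ 0 < t < T.
    by split => //; apply/in0T/(inner t t tt); rewrite lexx lerDl ltW.
  have /andP[_ ltT] := tT.
  have pt0 : 0 < p t by rewrite invr_gt0 subr_gt0.
  have ptc : p t <= c by rewrite lef_pV2 ?posrE ?subr_gt0// lerB// ltW// (le_lt_trans t2t).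
  have := dotv_le_sup (fun i => phile t i tt) (fun i => DXle t i tt).
  have mon := AM (X (t + h)) (X t); rewrite -/(DX t) in mon.
  have dXE : dX t = - (DZ t + (A (X (t + h)) - A (X t))).
    by apply/rowP => i; rewrite /dX /W /DZ !mxE; ring.
  have pT : p t * (T - t) = 1 by rewrite mulVf// lt0r_neq0// subr_gt0.
  move=> phi; rewrite /dN dXE (le_trans (scaled_difference_rate pt0 ptc pT mon phi))//.
  by rewrite le_eqVlt /C; apply/orP; left; apply/eqP; ring.
pose k := C * h ^+ 3.
rewrite (_ : C * _ * _ = k * t2 - k * t1); last by rewrite /k; ring.
apply: (@ler_is_derive _ N (fun t => k * t) dN (cst k)) => //.
- by apply: is_derive_within N'.
- by apply: (is_derive_within (df := cst k)) => z _; exact: lin.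
- by move=> t /andP[? ?]; apply: N'; rewrite !ltW.
- by move=> t /andP[? ?]; apply: dNle; rewrite !ltW.
Unshelve. all: by end_near. Qed.

Lemma cvg_difference_quotient (t : R) : 0 < t < T ->
  h^-1 *: (X (t + h) - X t) @[h --> 0^'+] --> - W t.
Proof.
move=> tT; have [dX <-] := X' tT.
have H : h^-1 *: (X (h *: 1 + t) - X t) @[h --> 0^'+] --> 'D_1 X t.
  by apply: cvg_dnbhs_at_right; exact: dX.
apply: cvg_trans H; apply: near_eq_cvg; near=> h.
by rewrite [h *: 1]mulr1 [h + t]addrC.
Unshelve. all: by end_near. Qed.

(** Divided by [h ^+ 2], the estimate of [difference_quotient_le] has error [C * h], which vanishes
    in the limit. *)
Lemma velocity_nonincreasing (t1 t2 : R) : 0 < t1 -> t1 <= t2 -> t2 < T ->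
  (T - t2)^-1 ^+ 2 * dotv (W t2) (W t2) <= (T - t1)^-1 ^+ 2 * dotv (W t1) (W t1).
Proof.
move=> t10 t12 t2T.
have [C C0 HC] := difference_quotient_le t10 t12 t2T.
pose q t (h : R) := h^-1 *: (X (t + h) - X t).
have cq (t : R) : t1 <= t <= t2 -> dotv (q t h) (q t h) @[h --> 0^'+] --> dotv (W t) (W t).
  move=> /andP[? ?].
  have tT : 0 < t < T by rewrite (lt_le_trans t10)//= (le_lt_trans _ t2T).
  have cW := cvg_difference_quotient tT.
  have := cvg_dotv cW cW.
  by rewrite dotvNl dotvNr opprK; apply.
have Q1 : (T - t1)^-1 ^+ 2 * dotv (q t1 h) (q t1 h) @[h --> 0^'+] -->
    (T - t1)^-1 ^+ 2 * dotv (W t1) (W t1).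
  by apply: cvgM; [exact: cvg_cst|apply: cq; rewrite lexx].
have Q2 : (T - t2)^-1 ^+ 2 * dotv (q t2 h) (q t2 h) @[h --> 0^'+] -->
    (T - t2)^-1 ^+ 2 * dotv (W t2) (W t2).
  by apply: cvgM; [exact: cvg_cst|apply: cq; rewrite lexx andbT].
have Ch : C * h @[h --> 0^'+] --> C * 0.
  by apply: cvg_at_right_filter; apply: cvgM; [exact: cvg_cst|exact: cvg_id].
have H : (T - t2)^-1 ^+ 2 * dotv (q t2 h) (q t2 h) -
    ((T - t1)^-1 ^+ 2 * dotv (q t1 h) (q t1 h) + C * h) @[h --> 0^'+] -->
    (T - t2)^-1 ^+ 2 * dotv (W t2) (W t2) - (T - t1)^-1 ^+ 2 * dotv (W t1) (W t1).
  by have := cvgB Q2 (cvgD Q1 Ch); rewrite mulr0 addr0; apply.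
rewrite -subr_le0; apply: (cvgr_to_le H).
near=> h.
have h0 : 0 < h by near: h; exact: nbhs_right_gt.
have : C * h ^+ 3 = h ^+ 2 * (C * h) by ring.
have -> : dotv (q t1 h) (q t1 h) = h ^- 2 * dotv (X (t1 + h) - X t1) (X (t1 + h) - X t1).
  by rewrite dotvZl dotvZr mulrA -expr2 exprVn.
have -> : dotv (q t2 h) (q t2 h) = h ^- 2 * dotv (X (t2 + h) - X t2) (X (t2 + h) - X t2).
  by rewrite dotvZl dotvZr mulrA -expr2 exprVn.
move=> CE; rewrite subr_le0 -(ler_pM2l (exprn_gt0 2 h0)) mulrDr -CE.
rewrite ![h ^+ 2 * (_ * (_ * _))]mulrCA !mulVKf ?expf_neq0 ?lt0r_neq0//.
rewrite -lerBlDl; near: h; exact: HC.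
Unshelve. all: by end_near. Qed.

End velocity_bound.

(** * Convergence at [T] and the bound on the residual *)

Section terminal_limit.
Context {R : realType} {d : nat} (A : 'rV[R]_d -> 'rV[R]_d) (T : R).
Hypotheses (AL : lipschitz_op A) (AM : monotone_op A) (T0 : 0 < T).
Variables (X0 : 'rV[R]_d) (X Z : R -> 'rV[R]_d).
Hypothesis S : dual_anchor_sol A T X0 X Z.

Let W t := Z t + A (X t).

Let X' (t : R) (tT : 0 < t < T) : is_derive t 1 X (- W t) :=
  (dual_anchor_is_derive S tT).1.

Let Z' (t : R) (tT : 0 < t < T) : is_derive t 1 Z (- ((T - t)^-1 *: W t)) :=
  (dual_anchor_is_derive S tT).2.

(** As [|W t| / (T - t)] is nonincreasing, its value at an interior time, here [T / 2], bounds it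
    from then on. *)
Lemma terminal_velocity_bound : exists a K : R, [/\ 0 < a < T, 0 <= K &
  forall t i, a <= t < T -> `|W t ord0 i| <= K * (T - t)].
Proof.
pose a := T / 2.
have a0 : 0 < a by rewrite divr_gt0.
have aT : a < T by rewrite ltr_pdivrMr// mulr_natr mulr2n ltrDl.
pose k := (T - a)^-1 ^+ 2 * dotv (W a) (W a).
exists a, (Num.sqrt k); split; [by rewrite a0|exact: sqrtr_ge0|].
move=> t i /andP[at_ tT]; have Tt : 0 < T - t by rewrite subr_gt0.
have Wa := velocity_nonincreasing AL AM X' Z' a0 at_ tT.
rewrite -ler_pdivrMr// mulrC (le_trans _ (ler_wsqrtr Wa))//.
rewrite sqrtrM ?sqr_ge0// sqrtr_sqr (gtr0_norm (_ : 0 < (T - t)^-1)) ?invr_gt0//.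
by rewrite ler_wpM2l ?invr_ge0 ?(ltW Tt)// coord_le_enorm.
Qed.

(** Near [T] each coordinate of [X] has derivative at most [K * (T - t) <= K * T] in absolute value,
    hence a limit with linear rate. Since [W] tends to 0 and [A] is continuous,
    [Z + A XT = W - (A X - A XT)] tends to 0. *)
Lemma terminal_cvg : exists XT : 'rV[R]_d, exists a K : R,
  [/\ X t @[t --> T^'-] --> XT,
      Z t + A XT @[t --> T^'-] --> (0 : 'rV[R]_d),
      a < T, 0 <= K &
      forall t i, a <= t < T -> `|(X t - XT) ord0 i| <= K * (T - t)].
Proof.
have [a [K [/andP[a0 aT] K0 WK]]] := terminal_velocity_bound.
have /choice[l Xl] : forall i, exists l : R, X t ord0 i @[t --> T^'-] --> l /\
    forall t, a <= t < T -> `|X t ord0 i - l| <= K * T * (T - t).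
  move=> i.
  have [||l Xl Xb] := @cvg_left_bounded_derive _ (fun t => X t ord0 i)
      (fun t => (- W t) ord0 i) a T (K * T) aT.
  - move=> t /andP[at_ tT].
    have /X'/is_derive_rowP : 0 < t < T by rewrite (lt_le_trans a0).
    exact.
  - move=> t atT; rewrite mxE normrN (le_trans (WK t i atT))// ler_wpM2l//.
    by have /andP[at_ _] := atT; rewrite gerBl (le_trans (ltW a0)).
  by exists l.
pose XT : 'rV[R]_d := \row_i l i.
have cX : X t @[t --> T^'-] --> XT.
  by apply/cvg_rowP => i; rewrite mxE; exact: (Xl i).1.
have cA : A (X t) @[t --> T^'-] --> A XT by exact: cvg_lipschitz_op.
have cW : W t @[t --> T^'-] --> (0 : 'rV[R]_d).
  apply/cvg_rowP => i; rewrite mxE; apply/cvgrPdist_le => e e0; near=> t.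
  rewrite sub0r normrN.
  have at_ : a <= t by near: t; exact: nbhs_left_ge.
  have tT : t < T by near: t; exact: nbhs_left_lt.
  rewrite (le_trans (WK t i _)) ?at_// (@le_trans _ _ ((K + 1) * (T - t)))//.
    by rewrite ler_wpM2r ?lerDl// subr_ge0 ltW.
  have K1 : 0 < K + 1 by rewrite ltr_wpDl.
  rewrite -ler_pdivlMl// lerBlDl -lerBlDr; near: t; apply: nbhs_left_ge.
  by rewrite ltrBlDr ltrDl mulr_gt0// invr_gt0 ltr_wpDl.
exists XT, a, (K * T); split; [exact: cX| |exact: aT| |].
- have : W t - (A (X t) - A XT) @[t --> T^'-] --> (0 : 'rV[R]_d) - (A XT - A XT).
    by apply: cvgB; [exact: cW|apply: cvgB; [exact: cA|exact: cvg_cst]].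
  rewrite subrr subr0; apply: cvg_trans; apply: near_eq_cvg; near=> t.
  by apply/rowP => i; rewrite /W !mxE; ring.
- by rewrite mulr_ge0// ltW.
- by move=> t i atT; rewrite !mxE; exact: (Xl i).2.
Unshelve. all: by end_near. Qed.

(** The claim is [0 <= V 0] for the [V] below. For every [e > 0] some [b] near [T] has [- e <= V b],
    and [V b <= V 0]. *)
Lemma terminal_energy_ge0 XT a K :
  Z t + A XT @[t --> T^'-] --> (0 : 'rV[R]_d) -> a < T -> 0 <= K ->
  (forall t i, a <= t < T -> `|(X t - XT) ord0 i| <= K * (T - t)) ->
  0 <= T^-1 * dotv (A XT) (X0 - XT) - dotv (A XT) (A XT) / 2.
Proof.
move=> cU aT K0 YK; have [X00 Z00 X0c Z0c _] := S.
pose U t := Z t + A XT; pose Y t := X t - XT; pose p (t : R) := (T - t)^-1.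
(* The factor 1/2 makes the two [<U, W>] terms of the derivative cancel; the rest combines through
   [A X - A XT = W - U]. *)
pose V t := p t * dotv (U t) (Y t) - dotv (U t) (U t) / 2.
pose dV t := - (p t ^+ 2 * dotv (A (X t) - A XT) (Y t)).
have V' (t : R) : 0 < t < T -> is_derive t 1 V (dV t).
  move=> tT; have /andP[t0 ltT] := tT.
  have U' : is_derive t 1 U (- (p t *: W t)).
    have := is_deriveD (Z' tT) (is_derive_cst (A XT) t 1).
    by rewrite addr0; apply.
  have Y' : is_derive t 1 Y (- W t).
    have := is_deriveB (X' tT) (is_derive_cst XT t 1).
    by rewrite subr0; apply.
  have H := is_deriveB (is_deriveM (is_derive_subV ltT) (is_derive_dotv U' Y'))
    (is_deriveZ 2^-1 (is_derive_dotv U' U')).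
  rewrite (_ : V = p * (fun s => dotv (U s) (Y s)) -
      2^-1 \*: (fun s => dotv (U s) (U s))); last first.
    by apply/funext => s; rewrite /V [_ / 2]mulrC.
  apply: (is_derive_eq H); rewrite /dV /GRing.scale/= -/(p t).
  have -> : A (X t) - A XT = W t - U t by rewrite /W /U opprD addrACA subrr add0r.
  move: (U t) (Y t) (W t) => u y w.
  by rewrite !dotvE (dotvC w u); field.
have V0 : V 0 = T^-1 * dotv (A XT) (X0 - XT) - dotv (A XT) (A XT) / 2.
  by rewrite /V /p /U /Y subr0 X00 Z00 add0r.
have cV0 : V t @[t --> 0^'+] --> V 0.
  have cU0 : U t @[t --> 0^'+] --> U 0.
    by rewrite /U Z00; apply: cvgD => //; exact: cvg_cst.
  have cY0 : Y t @[t --> 0^'+] --> Y 0.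
    by rewrite /Y X00; apply: cvgB => //; exact: cvg_cst.
  have cp : p t @[t --> 0^'+] --> p 0.
    apply: cvg_at_right_filter.
    exact: is_derive_continuous (is_derive_subV T0).
  exact: (cvgB (cvgM cp (cvg_dotv cU0 cY0))
    (cvgM (cvg_dotv cU0 cU0) (cvg_cst _))).
have Vle (b : R) : 0 < b -> b < T -> V b <= V 0.
  move=> b0 bT; rewrite -subr_le0 -[leRHS](subrr (0 : R)).
  apply: (@ler_is_derive _ V (cst 0) dV (cst 0)).
  - exact: ltW.
  - apply: is_derive_within_right b0 _ cV0 => t /andP[t0 tb].
    by apply: V'; rewrite t0 (le_lt_trans tb).
  - by apply: continuous_subspaceT => x; exact: cvg_cst.
  - by move=> t /andP[t0 tb]; apply: V'; rewrite t0 (lt_trans tb).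
  - by move=> t _; rewrite oppr_le0 mulr_ge0 ?sqr_ge0//; exact: AM.
rewrite -V0; apply/ler_addgt0Pl => e e0.
(* [eps] will bound the coordinates of [U b]. The first term of [V b] is then at most
   [d%:R * K * eps] in absolute value, the second at most [d%:R * eps] because [eps <= 1]; together,
   at most [D * eps <= e]. *)
pose D := d%:R * (K + 1) : R.
have D0 : 0 <= D by rewrite mulr_ge0// addr_ge0.
pose eps := Num.min 1 (e / (D + 1)).
have D1 : 0 < D + 1 by rewrite ltr_wpDl.
have eps0 : 0 < eps by rewrite lt_min ltr01 divr_gt0.
have eps1 : eps <= 1 by rewrite ge_min lexx.
have Deps : D * eps <= e.
  rewrite (@le_trans _ _ ((D + 1) * eps))//.
    by rewrite ler_wpM2r ?lerDl// ltW.
  by rewrite mulrC -ler_pdivlMr// ge_min lexx orbT.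
have [b [b0 ab bT Ub]] : exists b : R,
    [/\ 0 < b, a <= b, b < T & forall i, `|U b ord0 i| <= eps].
  near T^'- => b; exists b; split.
  - by near: b; exact: nbhs_left_gt.
  - by near: b; exact: nbhs_left_ge.
  - by near: b; exact: nbhs_left_lt.
  - move=> i; move: i; near: b; apply: filter_forall => i.
    have /cvg_rowP/(_ i)/cvgrPdist_le/(_ _ eps0) := cU.
    by apply: filterS => x; rewrite mxE sub0r normrN.
apply: (@le_trans _ _ (e + V b)); last by rewrite lerD2l Vle.
have Yb i : `|Y b ord0 i| <= K * (T - b) by apply: YK; rewrite ab bT.
have p0 : 0 < p b by rewrite invr_gt0 subr_gt0.
(* The linear rate of [Y] compensates the singular factor [p b]. *)
have UY : p b * `|dotv (U b) (Y b)| <= d%:R * K * eps.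
  rewrite (le_trans (ler_wpM2l (ltW p0) (dotv_le_sup Ub Yb)))//.
  rewrite le_eqVlt; apply/orP; left; apply/eqP; rewrite /p; field.
  by rewrite lt0r_neq0// subr_gt0.
have UU : dotv (U b) (U b) <= d%:R * eps.
  rewrite (le_trans (ler_norm _))// (le_trans (dotv_le_sup Ub Ub))//.
  by rewrite ler_wpM2l// ler_piMr// ltW.
have UY' : - (p b * `|dotv (U b) (Y b)|) <= p b * dotv (U b) (Y b).
  by rewrite -mulrN ler_wpM2l ?(ltW p0)// lerNl -normrN ler_norm.
have UU0 := dotv_ge0 (U b).
by move: UY UU UY' UU0 Deps; rewrite /V /D; lra.
Unshelve. all: by end_near. Qed.

Lemma terminal_residual_le XT Xs :
  0 <= T^-1 * dotv (A XT) (X0 - XT) - dotv (A XT) (A XT) / 2 -> A Xs = 0 ->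
  enorm (A XT) ^+ 2 <= 4 * enorm (X0 - Xs) ^+ 2 / T ^+ 2.
Proof.
move=> V0 As; rewrite !enorm_sqr.
have := AM XT Xs; rewrite As subr0 => mon.
(* With the scale [2 / T] the left side is at least [2 * |A XT|^2], by [V0] and [mon]; subtracting
   the [|A XT|^2] on the right leaves the claim. *)
have := dotv_amgm (A XT) ((2 / T) *: (X0 - Xs)).
rewrite dotvZr dotvZl dotvZr.
have -> : X0 - Xs = (X0 - XT) + (XT - Xs) by rewrite addrA subrK.
rewrite (dotvDr (A XT)).
have Tm : 0 <= T^-1 * dotv (A XT) (XT - Xs) by rewrite mulr_ge0// invr_ge0 ltW.
move: V0 Tm; move: (dotv (A XT) (X0 - XT)) (dotv (A XT) (XT - Xs)).
move: (dotv (_ + _) _) (dotv (A XT) (A XT)) => xx aa u v V0 Tm.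
rewrite (_ : 2 / T * (2 / T * xx) = 4 * xx / T ^+ 2); last first.
  by field; rewrite lt0r_neq0.
rewrite (_ : 2 * (2 / T * (u + v)) = 4 * (T^-1 * u) + 4 * (T^-1 * v)); last by ring.
lra.
Qed.

End terminal_limit.

Unset Implicit Arguments.

Theorem theorem7p1 (R : realType) (d : nat) (A : 'rV[R]_d -> 'rV[R]_d)
  (T : R) (X0 : 'rV[R]_d) :
  lipschitz_op A -> monotone_op A -> 0 < T ->
  exists X Z : R -> 'rV[R]_d,
    [/\ dual_anchor_sol A T X0 X Z,
        (forall X' Z' : R -> 'rV[R]_d, dual_anchor_sol A T X0 X' Z' ->
           forall t : R, 0 <= t < T -> X' t = X t /\ Z' t = Z t) &
        exists XT : 'rV[R]_d,
          X t @[t --> T^'-] --> XT /\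
          forall Xs : 'rV[R]_d, A Xs = 0 ->
            enorm (A XT) ^+ 2 <= 4 * enorm (X0 - Xs) ^+ 2 / T ^+ 2].
Proof.
move=> AL AM T0.
have [X [Z S]] := dual_anchor_exists AL T0 X0.
have [XT [a [K [cX cU aT K0 YK]]]] := terminal_cvg AL AM T0 S.
exists X, Z; split; first exact: S.
- by move=> X' Z' S' t tT; exact: (dual_anchor_unique AL AM S S').
exists XT; split; first exact: cX.
move=> Xs As; apply: terminal_residual_le => //.
exact: (terminal_energy_ge0 AM T0 S cU aT K0 YK).
Qed.
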